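(* Let $Y$ be a continuous Lagrangian path on $[a,b]$ with upper $n\times n$ block $X(t)$. Then its oscillation number and dual oscillation number on $[a,b]$ are related by $$\mathcal N(Y,[a,b])+\operatorname{rank}X(b)=\mathcal N^*(Y,[a,b])+\operatorname{rank}X(a).$$
   Context: Notation. $n\in\mathbb N$, $[a,b]\subseteq\mathbb R$, $\mathcal J=\begin{pmatrix}0&I\\ -I&0\end{pmatrix}\in\mathbb R^{2n\times2n}$, $E=\begin{pmatrix}0\\ I\end{pmatrix}\in\mathbb R^{2n\times n}$. A real $2n\times 2n$ matrix $S$ is symplectic if $S^T\mathcal JS=\mathcal J$. A Lagrangian plane is a constant $Y\in\mathbb R^{2n\times n}$ with $Y^T\mathcal JY=0$ and $\operatorname{rank}Y=n$. A continuous Lagrangian path on $[a,b]$ is a continuous $Y:[a,b]\to\mathbb R^{2n\times n}$ such that every $Y(t)$ is a Lagrangian plane. We write $Y=\begin{pmatrix}X\\ U\end{pmatrix}$ with $n\times n$ blocks (similarly $\hat Y$ with $\hat X,\hat U$). The Wronskian is $W(Y,\hat Y)=Y^T\mathcal J\hat Y$. Comparative index. For Lagrangian planes $Y,\hat Y$ put $\mathcal M=(I-X^\dagger X)W(Y,\hat Y)$, $V=I-\mathcal M^\dagger\mathcal M$, $\mathcal P=V[W(Y,\hat Y)]^TX^\dagger\hat XV$ (a symmetric matrix), where $\dagger$ is the Moore–Penrose pseudoinverse. The comparative index and dual comparative index are $\mu(Y,\hat Y)=\operatorname{rank}\mathcal M+\operatorname{ind}\mathcal P$, $\mu^*(Y,\hat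 Y)=\operatorname{rank}\mathcal M+\operatorname{ind}(-\mathcal P)$, with $\operatorname{ind}$ the number of negative eigenvalues. Oscillation numbers. For a continuous Lagrangian path $Y$ on $[a,b]$ take a partition $a=t_0<t_1<\dots<t_p=b$ and real symplectic matrix functions $R_k(t)$, $k=0,\dots,p-1$, with $R_k$ continuous on $[t_k,t_{k+1}]$ and such that, for each $k$, both $\operatorname{rank}W(R_k(t)E,Y(t))$ and $\operatorname{rank}\big((I\ \,0)R_k(t)E\big)$ are constant for $t\in[t_k,t_{k+1}]$. Then $$\mathcal N(Y,[a,b]):=\sum_{k=0}^{p-1}\big[\mu(Y(t_{k+1}),R_k(t_{k+1})E)-\mu(Y(t_k),R_k(t_k)E)\big],$$ $$\mathcal N^*(Y,[a,b]):=\sum_{k=0}^{p-1}\big[\mu^*(Y(t_k),R_k(t_k)E)-\mu^*(Y(t_{k+1}),R_k(t_{k+1})E)\big].$$ Such partitions and systems exist and the values do not depend on their choice. *)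

(* Defs.v *)
From HB Require Import structures.
From mathcomp Require Import all_boot all_order all_algebra.
From mathcomp Require Import polyrcf.
From mathcomp Require Import all_classical all_reals all_analysis.
Set Implicit Arguments.
Unset Strict Implicit.
Unset Printing Implicit Defensive.
Import Order.TTheory GRing.Theory Num.Theory.
Import numFieldNormedType.Exports.
Local Open Scope classical_set_scope.
Local Open Scope ring_scope.

Section MoorePenrose.
Variable R : realType.

(* The four Penrose conditions; on real matrices the adjoint is the
   transpose. *)
Definition penrose (m n : nat) (A : 'M[R]_(m, n)) (B : 'M[R]_(n, m)) : Prop :=
  [/\ A *m B *m A = A, B *m A *m B = B,
      (A *m B)^T = A *m B & (B *m A)^T = B *m A].

Definition mp_pinv (m n : nat) (A : 'M[R]_(m, n)) : 'M[R]_(n, m) :=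
  xget 0 [set B | penrose A B].

Lemma penrose_uniq (m n : nat) (A : 'M[R]_(m, n)) (B C : 'M[R]_(n, m)) :
  penrose A B -> penrose A C -> B = C.
Proof.
move=> [ABA BAB ABt BAt] [ACA CAC ACt CAt].
have EB : B = B *m A *m C.
  rewrite -{1}BAB -mulmxA -ABt -{1}ACA -(mulmxA (A *m C)) trmx_mul ABt ACt.
  by rewrite !mulmxA BAB.
have EC : C = B *m A *m C.
  rewrite -{1}CAC -CAt -{1}ABA !mulmxA -(mulmxA (C *m A)) trmx_mul BAt CAt.
  by rewrite -!mulmxA (mulmxA C) CAC.
by rewrite EB -EC.
Qed.

Lemma row_free_gram (m n : nat) (F : 'M[R]_(m, n)) :
  row_free F -> F *m F^T \in unitmx.
Proof.
move=> Ffree; rewrite -row_free_unit -kermx_eq0; apply/eqP/row_matrixP => i.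
rewrite row0; set v := row i _.
have v0 : v *m (F *m F^T) = 0 by rewrite -row_mul mulmx_ker row0.
have vF0 : v *m F = 0.
  have : (v *m F) *m (v *m F)^T = 0.
    by rewrite trmx_mul !mulmxA -(mulmxA v F) v0 mul0mx.
  move/matrixP => /(_ 0 0); rewrite !mxE => s0; apply/rowP => j.
  have /psumr_eq0P/(_ s0 j isT) :
      forall k, true -> 0 <= (v *m F) 0 k * (v *m F)^T k 0.
    by move=> k _; rewrite [_^T _ _]mxE -expr2 sqr_ge0.
  by move=> /eqP; rewrite [_^T _ _]mxE -expr2 sqrf_eq0 => /eqP ->; rewrite !mxE.
by apply: (row_free_inj Ffree); rewrite vF0 mul0mx.
Qed.

Lemma penrose_full_rank (m r n : nat) (C : 'M[R]_(m, r)) (F : 'M[R]_(r, n)) :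
  row_free C^T -> row_free F -> exists B, penrose (C *m F) B.
Proof.
move=> Cfull Ffree.
have uF := row_free_gram Ffree.
have uC : C^T *m C \in unitmx by have := row_free_gram Cfull; rewrite trmxK.
pose G := invmx (F *m F^T); pose H := invmx (C^T *m C).
have tG : G^T = G by rewrite /G trmx_inv trmx_mul trmxK.
have tH : H^T = H by rewrite /H trmx_inv trmx_mul trmxK.
have hF p (X : 'M[R]_(r, p)) : F *m (F^T *m (G *m X)) = X.
  by rewrite !mulmxA mulmxV// mul1mx.
have hC p (X : 'M[R]_(r, p)) : H *m (C^T *m (C *m X)) = X.
  by rewrite (mulmxA C^T) (mulmxA H) mulVmx// mul1mx.
have AB : C *m F *m (F^T *m G *m H *m C^T) = C *m H *m C^T.
  by rewrite -!mulmxA hF.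
have BA : F^T *m G *m H *m C^T *m (C *m F) = F^T *m G *m F.
  by rewrite -!mulmxA hC.
exists (F^T *m G *m H *m C^T); split.
- by rewrite AB -!mulmxA hC.
- by rewrite BA -!mulmxA hF.
- by rewrite AB !trmx_mul trmxK tH mulmxA.
- by rewrite BA !trmx_mul trmxK tG mulmxA.
Qed.

Lemma penrose_ex (m n : nat) (A : 'M[R]_(m, n)) : exists B, penrose A B.
Proof.
rewrite -{1}(mulmx_base A); apply: penrose_full_rank; last exact: row_base_free.
by rewrite /row_free mxrank_tr; exact: col_base_full.
Qed.

Lemma mp_pinvP (m n : nat) (A : 'M[R]_(m, n)) : penrose A (mp_pinv A).
Proof. by have [B AB] := penrose_ex A; exact: (xgetPex 0 (ex_intro _ B AB)). Qed.

End MoorePenrose.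

Section Symplectic.
Variables (R : realType) (n : nat).

Definition Jmx : 'M[R]_(n + n) := block_mx 0 1%:M (- 1%:M) 0.

Definition Emx : 'M[R]_(n + n, n) := col_mx 0 1%:M.

Definition symplectic (S : 'M[R]_(n + n)) : Prop := S^T *m Jmx *m S = Jmx.

Definition lagrangian_plane (Y : 'M[R]_(n + n, n)) : Prop :=
  Y^T *m Jmx *m Y = 0 /\ \rank Y = n.

Definition lagrangian_path (a b : R) (Y : R -> 'M[R]_(n + n, n)) : Prop :=
  {within `[a, b], continuous Y} /\
  (forall t, t \in `[a, b] -> lagrangian_plane (Y t)).

Definition wronskian (Y Z : 'M[R]_(n + n, n)) : 'M[R]_n := Y^T *m Jmx *m Z.

(* Number of negative eigenvalues, counted with (algebraic) multiplicity.
   [rootsR p] lists each real root of [p] once. *)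
Definition ind (P : 'M[R]_n) : nat :=
  \sum_(x <- rootsR (char_poly P) | x < 0) mup x (char_poly P).

Definition comp_M (Y Z : 'M[R]_(n + n, n)) : 'M[R]_n :=
  (1%:M - mp_pinv (usubmx Y) *m usubmx Y) *m wronskian Y Z.

Definition comp_V (Y Z : 'M[R]_(n + n, n)) : 'M[R]_n :=
  1%:M - mp_pinv (comp_M Y Z) *m comp_M Y Z.

Definition comp_P (Y Z : 'M[R]_(n + n, n)) : 'M[R]_n :=
  comp_V Y Z *m (wronskian Y Z)^T *m mp_pinv (usubmx Y) *m usubmx Z
    *m comp_V Y Z.

Definition comp_index (Y Z : 'M[R]_(n + n, n)) : nat :=
  (\rank (comp_M Y Z) + ind (comp_P Y Z))%N.

Definition dual_comp_index (Y Z : 'M[R]_(n + n, n)) : nat :=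
  (\rank (comp_M Y Z) + ind (- comp_P Y Z))%N.

(* [osc_mx S k] and [osc_pt S k] are only meaningful for k < osc_size S and
   k <= osc_size S respectively. *)
Record osc_system := OscSystem {
  osc_size : nat;
  osc_pt : nat -> R;
  osc_mx : nat -> R -> 'M[R]_(n + n) }.

HB.instance Definition _ := gen_eqMixin osc_system.
HB.instance Definition _ := gen_choiceMixin osc_system.

(* [osc_size S = 0] is possible only when a = b. *)
Definition osc_admissible (a b : R) (Y : R -> 'M[R]_(n + n, n))
    (S : osc_system) : Prop :=
  [/\ osc_pt S 0%N = a, osc_pt S (osc_size S) = b &
   forall k : nat, (k < osc_size S)%N ->
    let I := `[osc_pt S k, osc_pt S k.+1] in
    [/\ osc_pt S k < osc_pt S k.+1,
        {within [set` I], continuous (osc_mx S k)},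
        (forall t, t \in I -> symplectic (osc_mx S k t)),
        (forall s t, s \in I -> t \in I ->
           \rank (wronskian (osc_mx S k s *m Emx) (Y s)) =
           \rank (wronskian (osc_mx S k t *m Emx) (Y t))) &
        (forall s t, s \in I -> t \in I ->
           \rank (usubmx (osc_mx S k s *m Emx)) =
           \rank (usubmx (osc_mx S k t *m Emx)))]].

(* A choice of admissible system; both oscillation numbers are computed from
   it, their values being independent of that choice. *)
Definition osc_choice (a b : R) (Y : R -> 'M[R]_(n + n, n)) : osc_system :=
  xget (OscSystem 0 (fun=> 0) (fun _ _ => 0)) [set S | osc_admissible a b Y S].

Definition osc_number_of (Y : R -> 'M[R]_(n + n, n)) (S : osc_system) : int :=
  \sum_(k < osc_size S)
    let t := osc_pt S in let Q := osc_mx S k in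
    ((comp_index (Y (t k.+1)) (Q (t k.+1) *m Emx))%:Z
     - (comp_index (Y (t k)) (Q (t k) *m Emx))%:Z).

Definition dual_osc_number_of (Y : R -> 'M[R]_(n + n, n)) (S : osc_system)
    : int :=
  \sum_(k < osc_size S)
    let t := osc_pt S in let Q := osc_mx S k in
    ((dual_comp_index (Y (t k)) (Q (t k) *m Emx))%:Z
     - (dual_comp_index (Y (t k.+1)) (Q (t k.+1) *m Emx))%:Z).

Definition osc_number (a b : R) (Y : R -> 'M[R]_(n + n, n)) : int :=
  osc_number_of Y (osc_choice a b Y).

Definition dual_osc_number (a b : R) (Y : R -> 'M[R]_(n + n, n)) : int :=
  dual_osc_number_of Y (osc_choice a b Y).

End Symplectic.

(* Main.v *)
(* Each summand of N and N^* involves a pair of Lagrangian planes Y, Z = R_k E,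
   and everything follows from the identity
     mu(Y, Z) + mu^*(Y, Z) = rank Xh - rank X + rank W(Y, Z),
   since rank Xh and rank W are constant on each subinterval, so that the
   difference N - N^* telescopes to rank X(a) - rank X(b).  As P is symmetric,
   ind P + ind (- P) = rank P, and the identity becomes
     2 rank M + rank P = rank Xh - rank X + rank W.
   Here V projects onto ker M, so rank (Xh V) = rank Xh - rank M and
   rank (W V) = rank W - rank M, while im (Xh V) and im X have the same
   intersection with the kernel of V W^T X^+; applying rank-nullity to
   V W^T X^+ on both spaces gives rank P = rank (Xh V) - rank X + rank (W V).
   An admissible system exists because a constant Lagrangian plane transversal
   to Y(c) remains transversal to Y(t) for t near c. *)
Require Import Defs.
From mathcomp Require Import all_boot all_order all_algebra.
From mathcomp Require Import polyrcf complex spectral sesquilinear.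
From mathcomp Require Import zify lra.
From mathcomp Require Import all_classical all_reals all_analysis.
Set Implicit Arguments.
Unset Strict Implicit.
Unset Printing Implicit Defensive.
Import Order.TTheory GRing.Theory Num.Theory.
Import numFieldNormedType.Exports.
Local Open Scope ring_scope.

(** * Inertia and rank of real symmetric matrices *)

Lemma rank_diag_mx (F : fieldType) (n : nat) (d : 'rV[F]_n) :
  \rank (diag_mx d) = (\sum_(i < n) (d 0%R i != 0%R))%N.
Proof.
elim: n d => [|n IHn] d; first by rewrite big_ord0 [diag_mx _]flatmx0 mxrank0.
suff rank_row_mx (l : 'rV[F]_1) (r : 'rV[F]_n) : \rank (diag_mx (row_mx l r)) =
    (\sum_(i < 1 + n) (row_mx l r 0%R i != 0%R))%N.
  by have := rank_row_mx (@lsubmx _ _ 1 n d) (@rsubmx _ _ 1 n d);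
    rewrite hsubmxK.
rewrite diag_mx_row.
rewrite rank_diag_block_mx IHn big_split_ord /= big_ord1; congr addn.
  rewrite row_mxEl rank_rV; congr (nat_of_bool (~~ _)).
  apply/eqP/eqP => [/rowP/(_ 0)|h]; first by rewrite !mxE eqxx mulr1n.
  by apply/rowP => i; rewrite !ord1 [in LHS]mxE h mul0rn mxE.
by apply: eq_bigr => i _; rewrite row_mxEr.
Qed.

Lemma char_poly_similar (F : fieldType) (n : nat) (Q D : 'M[F]_n) :
  Q \in unitmx -> char_poly (invmx Q *m D *m Q) = char_poly D.
Proof.
move=> uQ; have iQ : map_mx polyC (invmx Q) *m map_mx polyC Q = 1%:M.
  by rewrite -map_mxM mulVmx// map_mx1.
rewrite /char_poly.
have -> : char_poly_mx (invmx Q *m D *m Q) =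
    map_mx polyC (invmx Q) *m char_poly_mx D *m map_mx polyC Q.
  rewrite /char_poly_mx mulmxBr mulmxBl !map_mxM; congr (_ - _).
  by rewrite mul_mx_scalar -scalemxAl iQ scalemx1.
by rewrite !det_mulmx mulrAC -det_mulmx iQ det1 mul1r.
Qed.

(** Each multiplicity is an occurrence count in [s]; after exchanging the sums, every negative [y]
    of [s] matches exactly one root, since [rootsR] has no repetitions. *)
Lemma ind_prod_XsubC (R : realType) (n : nat) (P : 'M[R]_n) (s : seq R) :
  char_poly P = \prod_(y <- s) ('X - y%:P) -> ind P = count (< 0) s.
Proof.
move=> Ps; rewrite /ind Ps.
have p0 : \prod_(y <- s) ('X - y%:P) != 0.
  by rewrite monic_neq0 ?monic_prod_XsubC.
have mem y : (y \in rootsR (\prod_(y <- s) ('X - y%:P))) = (y \in s).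
  have := roots_on_rootsR p0 y; rewrite root_prod_XsubC => <-.
  by rewrite in_itv.
under eq_bigr do rewrite mu_prod_XsubC -sum1_count big_mkcond /=.
rewrite exchange_big /= -sum1_count [RHS]big_mkcond /=.
apply: eq_big_seq => y ys; rewrite -big_mkcondr /=.
rewrite (eq_bigl (fun x => (x == y) && (y < 0))); last first.
  by move=> x /=; rewrite eq_sym andbC; case: eqP => // ->.
case: (y < 0); last by rewrite big1// => x; rewrite andbF.
under eq_bigl do rewrite andbT.
by rewrite sum1_count count_uniq_mem ?mem ?ys// uniq_roots.
Qed.

(* The spectral theorem is applied over [R[i]], where [P] is Hermitian. *)
Lemma symmetric_diagonalization (R : realType) (n : nat) (P : 'M[R]_n) :
  P^T = P -> exists d : 'rV[R]_n,
  [/\ char_poly P = \prod_(i < n) ('X - (d 0 i)%:P),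
      char_poly (- P) = \prod_(i < n) ('X - (- d 0 i)%:P) &
      \rank P = (\sum_(i < n) (d 0%R i != 0%R))%N].
Proof.
move=> PT; pose f := real_complex R; pose A := map_mx f P.
have Aherm : A \is hermsymmx.
  apply: realsym_hermsym.
    apply/is_hermitianmxP; rewrite expr0 scale1r.
    by apply/matrixP => i j; rewrite !mxE -[in LHS]PT mxE.
  by apply/mxOverP => i j; rewrite mxE; apply/complex_realP; exists (P i j).
pose Q := spectralmx A; pose e := spectral_diag A.
have uQ : Q \in unitmx by exact: spectral_unit.
have eA : A = invmx Q *m diag_mx e *m Q.
  by apply/orthomx_spectralP/hermitian_normalmx.
pose d := map_mx (@complex.Re R) e.
(* The eigenvalues of a Hermitian matrix are real, so the spectrum comes from [R]. *)
have ed : e = map_mx f d.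
  apply/rowP => i; rewrite !mxE.
  by have /mxOverP/(_ 0 i) := hermitian_spectral_diag_real Aherm; move=> /RRe_real.
have char_diag (c : 'rV[R]_n) :
    char_poly (diag_mx c) = \prod_(i < n) ('X - (c 0 i)%:P).
  rewrite char_poly_trig ?diag_mx_is_trig//; apply: eq_bigr => i _.
  by rewrite mxE eqxx mulr1n.
have finj : injective (map_poly f) by exact: map_poly_inj.
exists d; split.
- apply: finj; rewrite map_char_poly -/A eA char_poly_similar// ed.
  by rewrite -map_diag_mx -map_char_poly char_diag.
- apply: finj; rewrite map_char_poly map_mxN -/A eA -mulNmx -mulmxN.
  rewrite char_poly_similar// ed -map_diag_mx -map_mxN -map_char_poly.
  congr map_poly; have -> : - diag_mx d = diag_mx (- d).
    by apply/matrixP => i j; rewrite !mxE mulNrn.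
  by rewrite char_diag; under eq_bigr do rewrite mxE.
- rewrite -(mxrank_map f) -/A eA mxrankMfree ?row_free_unit//.
  rewrite -mxrank_tr trmx_mul mxrankMfree; last first.
    by rewrite row_free_unit unitmx_tr unitmx_inv.
  by rewrite mxrank_tr ed -map_diag_mx mxrank_map rank_diag_mx.
Qed.

(** A nonzero eigenvalue is negative for exactly one of [P] and [- P], and the rank of a
    diagonalizable matrix counts its nonzero eigenvalues. *)
Lemma ind_add_indN (R : realType) (n : nat) (P : 'M[R]_n) :
  P^T = P -> (ind P + ind (- P) = \rank P)%N.
Proof.
move=> /symmetric_diagonalization[d [Pd NPd ->]].
rewrite (@ind_prod_XsubC _ _ _ [seq d 0 i | i : 'I_n]); last first.
  by rewrite big_image.
rewrite (@ind_prod_XsubC _ _ _ [seq - d 0 i | i : 'I_n]); last first.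
  by rewrite big_image.
have countE (c : 'I_n -> R) :
    count (< 0) [seq c i | i : 'I_n] = (\sum_(i < n) (c i < 0)%R)%N.
  rewrite -sum1_count big_mkcond big_image /=.
  by apply: eq_bigr => i _; case: ifP.
rewrite !countE -big_split /=.
by apply: eq_bigr => i _; rewrite oppr_lt0; case: ltgtP.
Qed.

(** * The orthogonal projector onto the kernel of a matrix *)

Section KernelProjection.
Variables (R : realType) (m n : nat) (A : 'M[R]_(m, n)).

Let N : 'M[R]_n := 1%:M - mp_pinv A *m A.

Lemma mul_mp_compl : A *m N = 0.
Proof.
by have [AK _ _ _] := mp_pinvP A; rewrite mulmxBr mulmx1 mulmxA AK subrr.
Qed.

Lemma tr_mp_compl : N^T = N.
Proof. by have [_ _ _ AT] := mp_pinvP A; rewrite linearB /= AT trmx1. Qed.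

(** In row form [kermx A^T] is ker A, and [N] fixes each of its vectors. *)
Lemma eqmx_mp_compl : (N :=: kermx A^T)%MS.
Proof.
apply/eqmxP/andP; split.
  by apply/sub_kermxP; rewrite -[N]tr_mp_compl -trmx_mul mul_mp_compl trmx0.
rewrite -[X in (X <= _)%MS](_ : kermx A^T *m N = _) ?submxMl//.
rewrite -[N]tr_mp_compl linearB /= trmx1 mulmxBr mulmx1 trmx_mul mulmxA.
by rewrite mulmx_ker mul0mx subr0.
Qed.

Lemma rank_mp_compl : (\rank N + \rank A = n)%N.
Proof. by rewrite eqmx_mp_compl mxrank_ker mxrank_tr subnK// rank_leq_col. Qed.

(** The hypothesis says that ker T lies in ker A, so [T] maps ker A onto a space of dimension (n -
    rank A) - (n - rank T). *)
Lemma rank_mul_mp_compl (p : nat) (T : 'M[R]_(p, n)) :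
  (kermx T^T <= kermx A^T)%MS -> (\rank (T *m N) + \rank A = \rank T)%N.
Proof.
move=> kTA; rewrite -mxrank_tr trmx_mul tr_mp_compl.
have := mxrank_mul_ker N T^T; have := rank_mp_compl.
rewrite (capmx_idPr _); last by rewrite eqmx_mp_compl.
rewrite mxrank_ker mxrank_tr; have := rank_leq_col T.
by move: (\rank T) (\rank N) (\rank A) (\rank (N *m T^T)) => *; lia.
Qed.

End KernelProjection.

(** * The rank identity for a pair of Lagrangian planes *)

Section ComparativeIndexRank.
Variables (R : realType) (n : nat).
Implicit Types Y Z : 'M[R]_(n + n, n).

Lemma wronskian_blocks Y Z : wronskian Y Z =
  (usubmx Y)^T *m dsubmx Z - (dsubmx Y)^T *m usubmx Z.
Proof.
rewrite /wronskian -[in LHS](vsubmxK Y) -[in LHS](vsubmxK Z) tr_col_mx /Jmx.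
rewrite mul_row_block !mulmx0 add0r addr0 mulmxN !mulmx1 mul_row_col addrC.
by rewrite mulNmx.
Qed.

Lemma lagrangian_sym Y : lagrangian_plane Y ->
  (usubmx Y)^T *m dsubmx Y = (dsubmx Y)^T *m usubmx Y.
Proof.
case=> + _; rewrite -/(wronskian Y Y) wronskian_blocks => /eqP.
by rewrite subr_eq0 => /eqP.
Qed.

Lemma Jmx_sqr : Jmx R n *m Jmx R n = - 1%:M.
Proof.
rewrite /Jmx mulmx_block !(mulmx0, mul0mx, mulmx1, mul1mx, add0r, addr0).
by rewrite (scalar_mx_block n n) opp_block_mx !oppr0.
Qed.

Lemma Jmx_unit : Jmx R n \in unitmx.
Proof.
have: Jmx R n *m - Jmx R n = 1%:M by rewrite mulmxN Jmx_sqr opprK.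
by case/mulmx1_unit.
Qed.

Lemma tr_Jmx : (Jmx R n)^T = - Jmx R n.
Proof.
rewrite /Jmx tr_block_mx !trmx0 trmx1 linearN /= trmx1 opp_block_mx.
by rewrite !oppr0 opprK.
Qed.

Lemma rank_wronskianC Y Z : \rank (wronskian Y Z) = \rank (wronskian Z Y).
Proof.
rewrite -mxrank_tr /wronskian !trmx_mul trmxK tr_Jmx mulNmx mulmxN mxrank_opp.
by rewrite mulmxA.
Qed.

(** A Lagrangian plane lies in its J-orthogonal complement, and both have dimension n because J is
    invertible. *)
Lemma lagrangian_maximal (p : nat) (v : 'M[R]_(p, n + n)) Z :
  lagrangian_plane Z -> v *m Jmx R n *m Z = 0 -> (v <= Z^T)%MS.
Proof.
move=> [ZJZ rZ] /eqP; rewrite -mulmxA => /eqP/sub_kermxP vker.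
apply: submx_trans vker _.
have ZT : (Z^T <= kermx (Jmx R n *m Z))%MS by apply/sub_kermxP; rewrite mulmxA.
rewrite -(geq_leqif (mxrank_leqif_sup ZT)) mxrank_ker mxrank_tr.
rewrite -mxrank_tr trmx_mul mxrankMfree ?mxrank_tr ?rZ ?addnK//.
by rewrite row_free_unit unitmx_tr Jmx_unit.
Qed.

(* The column space of the upper block is the orthogonal complement of
   [U (ker X)]. *)
Lemma lagrangian_upper_block Y (X := usubmx Y) (U := dsubmx Y)
    (K := 1%:M - mp_pinv X *m X) :
  lagrangian_plane Y -> (X^T :=: kermx (U *m K))%MS.
Proof.
move=> LY; have XUK : X^T *m (U *m K) = 0.
  by rewrite mulmxA lagrangian_sym// -mulmxA mul_mp_compl mulmx0.
have XT : (X^T <= kermx (U *m K))%MS by apply/sub_kermxP.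
apply/eqmxP; rewrite XT -(geq_leqif (mxrank_leqif_sup XT)) mxrank_ker mxrank_tr.
(* [U] is injective on ker X: a common kernel vector of [X] and [U] would be killed by [Y], which
   has full column rank. *)
have -> : \rank (U *m K) = \rank K.
  rewrite -mxrank_tr trmx_mul tr_mp_compl -[RHS](mxrank_mul_ker K U^T).
  suff -> : (K :&: kermx U^T)%MS = 0 by rewrite mxrank0 addn0.
  apply/eqP; rewrite -submx0; apply/rV_subP => v.
  rewrite sub_capmx eqmx_mp_compl.
  move=> /andP[/sub_kermxP vX /sub_kermxP vU]; rewrite submx0.
  have YTfree : row_free Y^T by rewrite /row_free mxrank_tr LY.2.
  apply/eqP/(row_free_inj YTfree).
  by rewrite mul0mx -(vsubmxK Y) tr_col_mx mul_mx_row vX vU row_mx0.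
by have := rank_mp_compl X; rewrite -/K; lia.
Qed.

Section Pair.
Variables Y Z : 'M[R]_(n + n, n).
Hypotheses (LY : lagrangian_plane Y) (LZ : lagrangian_plane Z).

Let X := usubmx Y.
Let U := dsubmx Y.
Let Xh := usubmx Z.
Let Uh := dsubmx Z.
Let K : 'M[R]_n := 1%:M - mp_pinv X *m X.
Let W := wronskian Y Z.
Let M := comp_M Y Z.
Let V := comp_V Y Z.

Let VT : V^T = V. Proof. exact: tr_mp_compl. Qed.
Let MV : M *m V = 0. Proof. exact: mul_mp_compl. Qed.
Let KT : K^T = K. Proof. exact: tr_mp_compl. Qed.
Let KX : K *m X^T = 0.
Proof. by rewrite -[K]KT -trmx_mul mul_mp_compl trmx0. Qed.

(** [K] annihilates the first term of W = X^T Uh - U^T Xh. *)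
Let MT : M^T = - (Xh^T *m U *m K).
Proof.
rewrite /M /comp_M -/K wronskian_blocks mulmxBr mulmxA KX mul0mx sub0r.
by rewrite linearN /= !trmx_mul trmxK KT.
Qed.

(** [X^T (X^+)^T] is [1 - K], and [K W V = M V = 0]. *)
Let WV : X^T *m (mp_pinv X)^T *m W *m V = W *m V.
Proof.
have [_ _ _ XX] := mp_pinvP X; rewrite -trmx_mul XX.
have -> : mp_pinv X *m X = 1%:M - K by rewrite subKr.
by rewrite mulmxBl mul1mx mulmxBl (MV : K *m W *m V = 0) subr0.
Qed.

(** Orthogonality of im (Xh V) to U (ker X) amounts to [M V = 0]. *)
Let VXh_sub : (V *m Xh^T <= X^T)%MS.
Proof.
rewrite (lagrangian_upper_block LY); apply/sub_kermxP.
rewrite -[V]VT -!mulmxA (mulmxA Xh^T) -[Xh^T *m _ *m _]opprK -MT mulmxN.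
by rewrite -trmx_mul MV trmx0 oppr0.
Qed.

Let tr_comp_P : (comp_P Y Z)^T = V *m Xh^T *m ((mp_pinv X)^T *m W *m V).
Proof. by rewrite /comp_P -/V !trmx_mul !trmxK VT !mulmxA. Qed.

(** With [Xh V = X F^T], the transpose of P is a difference of congruences of [Xh^T Uh] and [U^T X],
    which are symmetric since [Z] and [Y] are Lagrangian. *)
Lemma comp_P_sym : (comp_P Y Z)^T = comp_P Y Z.
Proof.
have /submxP[F VXh] := VXh_sub.
have XhV : Xh *m V = X *m F^T.
  by rewrite -[Xh]trmxK -[V]VT -trmx_mul VXh trmx_mul trmxK.
have PT : (comp_P Y Z)^T = V *m (Xh^T *m Uh) *m V - F *m (U^T *m X) *m F^T.
  rewrite tr_comp_P VXh -(mulmxA F X^T) !(mulmxA X^T) WV /W wronskian_blocks.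
  rewrite mulmxBl mulmxBr; congr (_ - _); first by rewrite !mulmxA -VXh.
  by rewrite -!mulmxA XhV.
rewrite -[RHS]trmxK PT [RHS]linearB /= !trmx_mul VT !trmxK.
by rewrite -(lagrangian_sym LZ) (lagrangian_sym LY) !mulmxA.
Qed.

Let cap_eq : (V *m Xh^T :&: kermx ((mp_pinv X)^T *m W *m V) :=:
  X^T :&: kermx ((mp_pinv X)^T *m W *m V))%MS.
Proof.
apply/eqmxP; rewrite capmxS//= sub_capmx capmxSr andbT.
apply/rV_subP => v; rewrite sub_capmx => /andP[/submxP[c ->] /sub_kermxP].
rewrite -(mulmxA c X^T) !(mulmxA X^T) WV => cWV.
(* Passing from [c] to [c'] leaves [c X^T] unchanged, as [K X^T = 0], and this [e] makes [c' W]
   equal to [c W V], which vanishes. *)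
pose e := c *m W *m mp_pinv M; pose c' := c - e *m K.
have c'W : c' *m W = 0.
  rewrite /c' mulmxBl -[e *m K *m W]mulmxA -/(comp_M Y Z) -/M /e -mulmxA.
  by rewrite -[X in X - _]mulmx1 -mulmxBr -/V -mulmxA.
have c'X : c' *m X^T = c *m X^T by rewrite mulmxBl -mulmxA KX mulmx0 subr0.
(* So [c' Y^T] is J-orthogonal to [Z] and lies in the plane of [Z]; its upper block gives
   [c X^T = d Xh^T]. *)
have /(lagrangian_maximal LZ)/submxP[d] : (c' *m Y^T) *m Jmx R n *m Z = 0.
  by rewrite -!mulmxA (mulmxA Y^T).
rewrite -(vsubmxK Y) -(vsubmxK Z) !tr_col_mx !mul_mx_row => /eq_row_mx[].
rewrite -/X -/Xh c'X => cX _; rewrite cX submxMr//.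
(* What remains is [d M^T = 0], and [d M^T] equals [- c X^T U K]. *)
rewrite eqmx_mp_compl; apply/sub_kermxP; rewrite -/M MT mulmxN !mulmxA -cX.
rewrite -!mulmxA; have /sub_kermxP -> : (X^T <= kermx (U *m K))%MS.
  by rewrite (lagrangian_upper_block LY).
by rewrite mulmx0 oppr0.
Qed.

(** ker Xh and ker W lie in ker M, as [M = - K U^T Xh = K W]; this gives the ranks of [Xh V] and
    [W V]. By [cap_eq] the two rank-nullity identities share the term rank C, which cancels. *)
Lemma rank_comp_P :
  (\rank (comp_P Y Z) + \rank X + (\rank M).*2 = \rank Xh + \rank W)%N.
Proof.
have /rank_mul_mp_compl : (kermx Xh^T <= kermx M^T)%MS.
  by apply/sub_kermxP; rewrite MT mulmxN !mulmxA mulmx_ker !mul0mx oppr0.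
have /rank_mul_mp_compl : (kermx W^T <= kermx M^T)%MS.
  by apply/sub_kermxP; rewrite (trmx_mul K W) mulmxA mulmx_ker mul0mx.
rewrite -[1%:M - _]/V.
have := mxrank_mul_ker (V *m Xh^T) ((mp_pinv X)^T *m W *m V).
have := mxrank_mul_ker X^T ((mp_pinv X)^T *m W *m V).
rewrite -tr_comp_P cap_eq !(mulmxA X^T) WV -[V in V *m Xh^T]VT -trmx_mul.
rewrite !mxrank_tr.
set C := (X^T :&: _)%MS.
move: (\rank (comp_P Y Z)) (\rank C) (\rank (W *m V)) (\rank (Xh *m V)).
move: (\rank X) (\rank M) (\rank W) (\rank Xh) => *; lia.
Qed.

Lemma comp_index_add_dual :
  (comp_index Y Z + dual_comp_index Y Z + \rank X = \rank Xh + \rank W)%N.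
Proof.
rewrite /comp_index /dual_comp_index -rank_comp_P -(ind_add_indN comp_P_sym).
rewrite -/M; lia.
Qed.

End Pair.
End ComparativeIndexRank.

(** * Telescoping over an admissible system *)

Lemma symplectic_lagrangian (R : realType) (n : nat) (S : 'M[R]_(n + n)) :
  symplectic S -> lagrangian_plane (S *m Emx R n).
Proof.
move=> SJ; split.
  rewrite trmx_mul -!mulmxA (mulmxA (Jmx R n)) (mulmxA S^T) (mulmxA S^T) SJ.
  rewrite mulmxA /Emx /Jmx tr_col_mx mul_row_block mul_row_col.
  by rewrite !(mulmx0, mul0mx, trmx0, addr0).
have uS : S \in unitmx.
  have : \det (S^T *m Jmx R n *m S) \is a GRing.unit.
    by rewrite SJ -unitmxE Jmx_unit.
  by rewrite det_mulmx unitrM -unitmxE => /andP[].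
rewrite -mxrank_tr trmx_mul mxrankMfree ?row_free_unit ?unitmx_tr//.
by rewrite tr_col_mx trmx0 trmx1 rank_row_0mx mxrank1.
Qed.

(** Places the partition points in [a, b]; points beyond index [osc_size S] are unconstrained. *)
Lemma osc_pt_homo (R : realType) (n : nat) (a b : R) (Y : R -> 'M[R]_(n + n, n))
    (S : osc_system R n) (i j : nat) : osc_admissible a b Y S ->
  (i <= j <= osc_size S)%N -> osc_pt S i <= osc_pt S j.
Proof.
case=> _ _ adm; elim: j => [|j IHj] /andP[].
  by rewrite leqn0 => /eqP ->.
rewrite leq_eqVlt => /predU1P[->//|ij] jS.
have [/ltW + _ _ _ _] := adm j jS; apply: le_trans.
by apply: IHj; rewrite -ltnS ij ltnW.
Qed.

Lemma osc_number_of_add_rank (R : realType) (n : nat) (a b : R)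
    (Y : R -> 'M[R]_(n + n, n)) (S : osc_system R n) :
  (forall t, t \in `[a, b] -> lagrangian_plane (Y t)) ->
  osc_admissible a b Y S ->
  osc_number_of Y S + (\rank (usubmx (Y b)))%:Z =
  dual_osc_number_of Y S + (\rank (usubmx (Y a)))%:Z.
Proof.
move=> LY admS; have [S0 Sb adm] := admS.
rewrite /osc_number_of /dual_osc_number_of -[in Y b]Sb -[in Y a]S0.
pose t := osc_pt S; pose Z k s := osc_mx S k s *m Emx R n.
have LYt k : (k <= osc_size S)%N -> lagrangian_plane (Y (t k)).
  move=> kS; apply: LY; rewrite in_itv /= -S0 -Sb.
  by rewrite !(osc_pt_homo admS) ?leqnn ?kS.
(* Induction on the number [p] of subintervals summed, with [t p] in place of [b]. *)
elim: {-2}(osc_size S) (leqnn (osc_size S)) => [|p IHp] pS.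
  by rewrite !big_ord0.
have [tp _ sympl rkW rkX] := adm p pS.
have tp_in : t p \in `[t p, t p.+1] by rewrite in_itv /= lexx ltW.
have tp1_in : t p.+1 \in `[t p, t p.+1] by rewrite in_itv /= lexx ltW.
have LZ s : s \in `[t p, t p.+1] -> lagrangian_plane (Z p s).
  by move=> /sympl; exact: symplectic_lagrangian.
(* Subtracting the identities at the two ends cancels rank Xh and rank W, leaving the change of rank
   X. *)
have := comp_index_add_dual (LYt p (ltnW pS)) (LZ _ tp_in).
have := comp_index_add_dual (LYt p.+1 pS) (LZ _ tp1_in).
rewrite ![\rank (wronskian (Y _) _)]rank_wronskianC.
have := rkX _ _ tp_in tp1_in; have := rkW _ _ tp_in tp1_in.
have := IHp (ltnW pS).
rewrite !big_ord_recr /= -/t -/(Z p).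
rewrite -/(Z p (t p)) -/(Z p (t p.+1)).
move: (\sum_(k < p) _) (\sum_(k < p) _) => A B.
move: (comp_index _ _) (comp_index _ _) (dual_comp_index _ _).
move: (dual_comp_index _ _) (\rank _) (\rank _) (\rank _) (\rank _).
move: (\rank _) (\rank _) => *; lia.
Qed.

(** * Existence of admissible systems *)

(* [- J Y (Y^T Y)^-1] completes [Y] to a symplectic matrix. *)
Lemma lagrangian_transversal (R : realType) (n : nat) (Y : 'M[R]_(n + n, n)) :
  lagrangian_plane Y ->
  exists S, symplectic S /\ wronskian (S *m Emx R n) Y \in unitmx.
Proof.
move=> [YJY rY].
have uG : Y^T *m Y \in unitmx.
  have := @row_free_gram R _ _ Y^T; rewrite trmxK; apply.
  by rewrite /row_free mxrank_tr rY.
pose G := invmx (Y^T *m Y).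
have GT : G^T = G by rewrite /G trmx_inv trmx_mul trmxK.
have [B BE] : exists B, B = - (Jmx R n *m Y *m G) by eexists.
have BT : B^T = G *m Y^T *m Jmx R n.
  by rewrite BE linearN /= !trmx_mul GT tr_Jmx mulmxN mulmxN opprK mulmxA.
have BJY : B^T *m Jmx R n *m Y = - 1%:M.
  rewrite BT -!mulmxA (mulmxA (Jmx R n) (Jmx R n)) Jmx_sqr mulNmx mul1mx.
  by rewrite !mulmxN mulVmx.
have YJB : Y^T *m Jmx R n *m B = 1%:M.
  have -> : Y^T *m Jmx R n *m B = - (B^T *m Jmx R n *m Y)^T.
    by rewrite !trmx_mul trmxK tr_Jmx mulNmx mulmxN opprK mulmxA.
  by rewrite BJY linearN /= trmx1 opprK.
have BJB : B^T *m Jmx R n *m B = 0.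
  rewrite BT -!mulmxA (mulmxA (Jmx R n) (Jmx R n)) Jmx_sqr mulNmx mul1mx.
  by rewrite BE opprK (mulmxA Y^T) (mulmxA Y^T) YJY mul0mx mulmx0.
(* The four products above are the blocks of [S^T J S]; moreover [S E = B], so the Wronskian with
   [Y] is [- I]. *)
exists (row_mx Y B); split.
  rewrite /symplectic tr_row_mx mul_col_mx mul_col_row YJY YJB BJY BJB.
  by [].
rewrite /Emx mul_row_col mulmx0 mulmx1 add0r /wronskian BJY.
by rewrite -scaleN1r unitmxZ ?unitmx1// unitrN1.
Qed.

(** By the Leibniz formula the determinant is a finite sum of finite products of entries. *)
Lemma cvg_det (R : realType) (n : nat) (T : Type) (F : set_system T)
    (A : T -> 'M[R]_n) (B : 'M[R]_n) : Filter F ->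
  (forall i j, A t i j @[t --> F] --> B i j)%classic ->
  (\det (A t) @[t --> F] --> \det B)%classic.
Proof.
move=> FF AB; apply: cvg_big => [|s _]; first exact: add_continuous.
apply: cvgM; first exact: cvg_cst.
by apply: cvg_big => [|i _]; [exact: mul_continuous | exact: AB].
Qed.

Lemma wronskian_unit_near (R : realType) (n : nat) (a b c : R)
    (Y : R -> 'M[R]_(n + n, n)) (Z : 'M[R]_(n + n, n)) :
  {within `[a, b], continuous Y}%classic -> c \in `[a, b] ->
  wronskian Z (Y c) \in unitmx ->
  exists2 e, 0 < e & forall t, t \in `[a, b] -> `|t - c| < e ->
    wronskian Z (Y t) \in unitmx.
Proof.
move=> cY cab; rewrite unitmxE unitfE => det0.
have Yc : (Y t @[t --> within `[a, b]%classic (nbhs c)] --> Y c)%classic.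
  by have /subspace_continuousP := cY; exact.
have Wc : (\det (wronskian Z (Y t)) @[t --> within `[a, b]%classic (nbhs c)]
    --> \det (wronskian Z (Y c)))%classic.
  apply: cvg_det => i j; rewrite /wronskian [in X in (_ --> X)%classic]mxE.
  under eq_cvg do rewrite mxE.
  apply: cvg_big => [|k _]; first exact: add_continuous.
  apply: cvgM; first exact: cvg_cst.
  exact: (cvg_comp _ _ Yc (@coord_continuous R _ _ k j (Y c))).
have /(_ _) := cvgr_neq0 _ Wc det0; rewrite near_withinE.
move=> /nbhs_ballP[e /= e0 He].
exists e => // t tab tc; rewrite unitmxE unitfE; apply: He => //.
by rewrite /ball /= distrC.
Qed.

(** On the added subinterval the matrix is the constant [Q]: the Wronskian keeps rank n and the
    upper block of [Q E] does not change. *)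
Lemma osc_admissible_extend (R : realType) (n : nat) (a s t : R)
    (Y : R -> 'M[R]_(n + n, n)) (S : osc_system R n) (Q : 'M[R]_(n + n)) :
  osc_admissible a s Y S -> s < t -> symplectic Q ->
  (forall r, r \in `[s, t] -> wronskian (Q *m Emx R n) (Y r) \in unitmx) ->
  exists S', osc_admissible a t Y S'.
Proof.
move=> [S0 Ss adm] st sQ uW; pose p := osc_size S.
(* The old system has [p + 1] points but only [p] matrices, hence the two different tests on [k]. *)
exists (OscSystem p.+1 (fun k => if (k <= p)%N then osc_pt S k else t)
  (fun k => if (k < p)%N then osc_mx S k else fun=> Q)).
split => /=; [by [] | by rewrite ltnn |].
move=> k; rewrite ltnS => kp'; have := kp'.
rewrite {1}leq_eqVlt => /predU1P[->|kp].
  rewrite !ltnn leqnn Ss; split => //.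
    by apply: continuous_subspaceT => x; exact: cvg_cst.
  by move=> x y /uW ux /uW uy; rewrite !mxrank_unit.
by rewrite kp kp'; exact: adm.
Qed.

Lemma osc_admissible_ex (R : realType) (n : nat) (a b : R)
    (Y : R -> 'M[R]_(n + n, n)) : a <= b -> lagrangian_path a b Y ->
  exists S, osc_admissible a b Y S.
Proof.
move=> ab [cY LY].
(* Continuous induction: the supremum of the reachable endpoints is shown to be [b], and
   attained. *)
pose A : set R :=
  [set s | a <= s <= b /\ exists S, osc_admissible a s Y S]%classic.
have Aa : A a.
  split; first by rewrite lexx.
  by exists (OscSystem 0 (fun=> a) (fun _ _ => 0)); split.
have supA : has_sup A.
  by split; [exists a | exists b => s [/andP[]]].
pose c := sup A.
have cab : c \in `[a, b].
  rewrite in_itv /= ub_le_sup//=; last by case: supA.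
  by apply: ge_sup; [exists a | move=> s [/andP[]]].
have [Q [sQ /(wronskian_unit_near cY cab)[e e0 uW]]] :=
  lagrangian_transversal (LY c cab).
have [s As cs] := sup_adherent e0 supA.
have sc : s <= c by apply: ub_le_sup => //; case: supA.
have [/andP[as_ sb] [S admS]] := As.
(* Either [t] is [b] or it exceeds [c], while [s, t] stays within distance [e] of [c]. *)
pose t := Num.min b (c + e / 2).
have tb : t <= b by rewrite /t ge_min lexx.
have tc : t <= c + e / 2 by rewrite /t ge_min lexx orbT.
have [st|ts] := ltP s t; last first.
  move: ts; rewrite /t ge_min => /orP[bs|]; last by lra.
  by exists S; have <- : s = b by apply/eqP; rewrite eq_le sb bs.
have uWst r : r \in `[s, t] -> wronskian (Q *m Emx R n) (Y r) \in unitmx.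
  rewrite in_itv /= => /andP[sr rt]; apply: uW.
    by rewrite in_itv /= (le_trans as_ sr) (le_trans rt tb).
  by rewrite ltr_norml; rewrite -/c in cs; lra.
have [S' admS'] := osc_admissible_extend admS st sQ uWst.
have At : A t by split; [rewrite (le_trans as_ (ltW st)) | exists S'].
(* This excludes [t = c + e / 2], so [t] must be [b]. *)
have tc' : t <= c by apply: ub_le_sup => //; case: supA.
exists S'; suff <- : t = b by [].
move: tc'; rewrite /t minEle; case: ifP => // _; lra.
Qed.

Unset Implicit Arguments.

Theorem theorem3p13 (R : realType) (n : nat) (a b : R)
    (Y : R -> 'M[R]_(n + n, n)) (hab : a <= b) (hY : lagrangian_path a b Y) :
  osc_number a b Y + (\rank (usubmx (Y b)))%:Z =
  dual_osc_number a b Y + (\rank (usubmx (Y a)))%:Z.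
Proof.
apply: osc_number_of_add_rank; first by case: hY.
(* Existence ensures that [osc_choice] is admissible and not merely the default of [xget]. *)
have [S admS] := osc_admissible_ex hab hY.
exact: (xgetPex _ (ex_intro _ S admS)).
Qed.
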